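(* Let $m=6+12q$ with $q=1+2d$ for a nonnegative integer $d$, and let $t=t(q)$. The minimal decomposition of $\mathbb{Z}_2$ for the Fibonacci polynomial $F_m$ is $$\mathbb{Z}_2=\{0\}\sqcup\Bigl(\bigcup_{n\ge 1}\bigcup_{k=0}^{2^{t+1}-1}M_{n,k}\Bigr)\sqcup(1+2\mathbb{Z}_2),$$ where $M_{n,k}=(1+2k)2^n+2^{n+t+2}\mathbb{Z}_2$. Here $\{0\}$ is the set of a fixed point, the $M_{n,k}$'s are the minimal components, and the clopen set $1+2\mathbb{Z}_2$ is the attracting basin of $\{0\}$ and the $M_{n,k}$'s.
   Context: $\mathbb{Z}_2$ is the ring of 2-adic integers with the 2-adic metric. The Fibonacci polynomials are defined by $F_0(x)=0$, $F_1(x)=1$, $F_m(x)=xF_{m-1}(x)+F_{m-2}(x)$ for $m\ge 2$. For a nonnegative integer $q$ with binary expansion $q=\sum_{i\ge 0}c_i2^i$, $c_i\in\{0,1\}$ (with $c_i=0$ for all large $i$), define $t(q)=\min\{i\ge 0: c_i=c_{i+1}\}$. For a polynomial $f$ over $\mathbb{Z}_2$, a minimal decomposition of $\mathbb{Z}_2$ for $f$ is a decomposition $\mathbb{Z}_2=\mathcal P\sqcup\mathcal M\sqcup\mathcal B$ (some parts possibly empty) in which: $\mathcal P$ is the finite set consisting of all periodic points of $f$; $\mathcal M=\bigsqcup_i\mathcal M_i$ is the union of all (at most countably many) clopen $f$-invariant sets $\mathcal M_i$ (the minimal components), each a finite union of balls, such that each $f:\mathcal M_i\to\mathcal M_i$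 is minimal (every orbit is dense in $\mathcal M_i$); and each point of $\mathcal B$ lies in the attracting basin of a periodic orbit or of a minimal subsystem. A point $x$ lies in the attracting basin of a set $C$ (a periodic orbit or minimal component) if the distance from $f^n(x)$ to $C$ tends to $0$ as $n\to\infty$; when a part $\mathcal B$ of a decomposition is said to be the attracting basin of several such sets, this means every point of $\mathcal B$ lies in the attracting basin of one of them. *)

(* Defs.v *)
From HB Require Import structures.
From Stdlib Require Import Rdefinitions.
From mathcomp Require Import Rstruct Rstruct_topology zify.
From mathcomp Require Import all_boot all_order all_algebra.
From mathcomp Require Import all_classical all_reals all_analysis.

Set Implicit Arguments.
Unset Strict Implicit.
Unset Printing Implicit Defensive.

Import Order.TTheory GRing.Theory Num.Theory.

Local Open Scope classical_set_scope.
Local Open Scope ring_scope.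

(* The inverse limit of the rings Z/2^n Z: [res x n] is the representative of
   x mod 2^n in {0, ..., 2^n - 1}.  [resP] forces both the compatibility of
   the residues and this choice of representatives. *)
Record Z2 := MkZ2 {
  res : nat -> int ;
  resP : forall n, (res n.+1 %% 2 ^+ n)%Z = res n }.

HB.instance Definition _ := gen_eqMixin Z2.
HB.instance Definition _ := gen_choiceMixin Z2.

Lemma Z2_ext (x y : Z2) : res x =1 res y -> x = y.
Proof.
case: x y => [u hu] [v hv] /= /funext uv; move: hu hv; rewrite uv => hu hv.
by congr MkZ2; exact: Prop_irrelevance.
Qed.

Lemma modz_pow2S (a : int) n : ((a %% 2 ^+ n.+1)%Z %% 2 ^+ n)%Z = (a %% 2 ^+ n)%Z.
Proof.
rewrite [in RHS](divz_eq a (2 ^+ n.+1)) exprSr [_ * 2]mulrC mulrA.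
by rewrite modzMDl.
Qed.

Lemma res_mod (x : Z2) n : (res x n %% 2 ^+ n)%Z = res x n.
Proof. by rewrite -(resP x n) modz_mod. Qed.

Definition Z2_of_int (a : int) : Z2 :=
  @MkZ2 (fun n => (a %% 2 ^+ n)%Z) (fun n => modz_pow2S a n).

Fact Z2_add_subproof (x y : Z2) n :
  (((res x n.+1 + res y n.+1) %% 2 ^+ n.+1)%Z %% 2 ^+ n)%Z =
  ((res x n + res y n) %% 2 ^+ n)%Z.
Proof. by rewrite modz_pow2S -modzDm !resP. Qed.

Definition Z2_add (x y : Z2) : Z2 := MkZ2 (Z2_add_subproof x y).

Fact Z2_opp_subproof (x : Z2) n :
  (((- res x n.+1) %% 2 ^+ n.+1)%Z %% 2 ^+ n)%Z = ((- res x n) %% 2 ^+ n)%Z.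
Proof. by rewrite modz_pow2S -modzNm resP. Qed.

Definition Z2_opp (x : Z2) : Z2 := MkZ2 (Z2_opp_subproof x).

Fact Z2_mul_subproof (x y : Z2) n :
  (((res x n.+1 * res y n.+1) %% 2 ^+ n.+1)%Z %% 2 ^+ n)%Z =
  ((res x n * res y n) %% 2 ^+ n)%Z.
Proof. by rewrite modz_pow2S -modzMm !resP. Qed.

Definition Z2_mul (x y : Z2) : Z2 := MkZ2 (Z2_mul_subproof x y).

Fact Z2_addA : associative Z2_add.
Proof.
by move=> x y z; apply: Z2_ext => n /=; rewrite modzDml modzDmr addrA.
Qed.

Fact Z2_addC : commutative Z2_add.
Proof. by move=> x y; apply: Z2_ext => n /=; rewrite addrC. Qed.

Fact Z2_add0 : left_id (Z2_of_int 0) Z2_add.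
Proof. by move=> x; apply: Z2_ext => n /=; rewrite mod0z add0r res_mod. Qed.

Fact Z2_addN : left_inverse (Z2_of_int 0) Z2_opp Z2_add.
Proof. by move=> x; apply: Z2_ext => n /=; rewrite modzDml addNr. Qed.

HB.instance Definition _ :=
  GRing.isZmodule.Build Z2 Z2_addA Z2_addC Z2_add0 Z2_addN.

Fact Z2_mulA : associative Z2_mul.
Proof.
by move=> x y z; apply: Z2_ext => n /=; rewrite modzMml modzMmr mulrA.
Qed.

Fact Z2_mulC : commutative Z2_mul.
Proof. by move=> x y; apply: Z2_ext => n /=; rewrite mulrC. Qed.

Fact Z2_mul1 : left_id (Z2_of_int 1) Z2_mul.
Proof. by move=> x; apply: Z2_ext => n /=; rewrite modzMml mul1r res_mod. Qed.

Fact Z2_mulDl : left_distributive Z2_mul Z2_add.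
Proof.
by move=> x y z; apply: Z2_ext => n /=; rewrite modzMml modzDm mulrDl.
Qed.

Fact Z2_oner_neq0 : Z2_of_int 1 != 0 :> Z2.
Proof. by apply/eqP => /(congr1 (fun x => res x 1)). Qed.

HB.instance Definition _ := GRing.Zmodule_isComNzRing.Build Z2
  Z2_mulA Z2_mulC Z2_mul1 Z2_mulDl Z2_oner_neq0.

Lemma res0 n : res 0 n = 0.
Proof. exact: mod0z. Qed.

Lemma resD (x y : Z2) n : res (x + y) n = ((res x n + res y n) %% 2 ^+ n)%Z.
Proof. by []. Qed.

Lemma resN (x : Z2) n : res (- x) n = ((- res x n) %% 2 ^+ n)%Z.
Proof. by []. Qed.

Lemma resB_eq0 (x y : Z2) n : (res (x - y) n == 0) = (res x n == res y n).
Proof.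
rewrite resD resN modzDmr -[LHS]/(_ == 0 :> int).
have -> : ((res x n - res y n) %% 2 ^+ n)%Z == 0 =
          (res x n == res y n %[mod 2 ^+ n])%Z.
  by rewrite eqz_mod_dvd; apply/eqP/idP => /dvdz_mod0P.
by rewrite !res_mod.
Qed.

Lemma res_at0 (x : Z2) : res x 0 = 0.
Proof. by rewrite -res_mod expr0 modz1. Qed.

Lemma res_eq0_le (x : Z2) n k : (k <= n)%N -> res x n = 0 -> res x k = 0.
Proof.
elim: n => [|n IHn]; first by rewrite leqn0 => /eqP ->.
rewrite leq_eqVlt => /predU1P[-> //|kn] xn; apply: IHn => //.
by rewrite -resP xn mod0z.
Qed.

Fact Z2_neq0_ex (x : Z2) : x != 0 -> exists n, res x n.+1 != 0.
Proof.
move=> x0; apply: contrapT => h; case/eqP: x0; apply: Z2_ext => -[|n].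
  by rewrite !res_at0.
by rewrite res0; apply: contrapT => /eqP xn; apply: h; exists n.
Qed.

(* The exponent of 2 in x, that is the largest n such that x = 0 mod 2^n;
   it is set to 0 for x = 0. *)
Definition val2 (x : Z2) : nat :=
  if pselect (exists n, res x n.+1 != 0) is left xn then ex_minn xn else 0%N.

Definition abs2 (x : Z2) : R := if x == 0 then 0 else 2 ^- val2 x.

Lemma abs2_le (x : Z2) n : (abs2 x <= 2 ^- n) = (res x n == 0).
Proof.
rewrite /abs2 /val2; case: (eqVneq x 0) => [->|x0].
  by rewrite res0 eqxx invr_ge0 exprn_ge0.
case: pselect => [xN|/(_ (Z2_neq0_ex x0))//]; case: ex_minnP => v xv vmin.
rewrite lef_pV2 ?posrE ?exprn_gt0// ler_eXn2l ?ltr1n//.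
apply/idP/idP => [nv|/eqP xn].
- case: n nv => [|n] nv; first by rewrite res_at0.
  apply/negPn/negP => /vmin; lia.
- rewrite leqNgt; apply/negP => vn.
  by move: xv; rewrite (res_eq0_le vn xn) eqxx.
Qed.

Definition dist2 (x y : Z2) : R := abs2 (x - y).

Fact dist2xx x : dist2 x x = 0.
Proof. by rewrite /dist2 /abs2 subrr eqxx. Qed.

Fact dist2_eq0 x y : dist2 x y = 0 -> x = y.
Proof.
rewrite /dist2 /abs2; case: (eqVneq (x - y) 0) => [/eqP|_ /eqP].
  by rewrite subr_eq0 => /eqP.
by rewrite invr_eq0 expf_eq0 pnatr_eq0 andbF.
Qed.

Fact abs2N x : abs2 (- x) = abs2 x.
Proof.
have h (y : Z2) n : res (- y) n == 0 = (res y n == 0).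
  by rewrite -[- y]add0r resB_eq0 res0 eq_sym.
rewrite /abs2 oppr_eq0; case: eqVneq => // x0; congr (2 ^- _).
rewrite /val2; case: pselect => [a|/(_ (Z2_neq0_ex _))]; last first.
  by rewrite oppr_eq0 => /(_ x0).
case: pselect => [b|/(_ (Z2_neq0_ex x0))//]; apply: eq_ex_minn => n.
by rewrite h.
Qed.

Fact dist2C x y : dist2 x y = dist2 y x.
Proof. by rewrite /dist2 -abs2N opprB. Qed.

Fact abs2_ge0 x : 0 <= abs2 x.
Proof. by rewrite /abs2; case: ifP => // _; rewrite invr_ge0 exprn_ge0. Qed.

Fact abs2D x y : abs2 (x + y) <= Num.max (abs2 x) (abs2 y).
Proof.
have H u v : abs2 u <= abs2 v -> abs2 (u + v) <= abs2 v.
  case: (eqVneq v 0) => [->|v0]; first by rewrite addr0.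
  rewrite {2 4}/abs2 (negPf v0) !abs2_le resD => /eqP ->.
  have /eqP -> : res v (val2 v) == 0 by rewrite -abs2_le /abs2 (negPf v0).
  by rewrite mod0z.
case: (leP (abs2 x) (abs2 y)) => [|/ltW] xy; first exact: H.
by rewrite addrC; exact: H.
Qed.

Fact dist2_triangle y x z : dist2 x z <= dist2 x y + dist2 y z.
Proof.
rewrite /dist2 -[x - z](subrKA y) (le_trans (abs2D _ _))// ge_max.
by rewrite lerDl lerDr !abs2_ge0.
Qed.

(* The cast to realType makes this instance inferable from Z2 alone in lemmas
   stated over a realType. *)
HB.instance Definition _ :=
  isMetric.Build (R : realType) Z2 dist2xx dist2_eq0 dist2C dist2_triangle.

Definition coset2 (a b : Z2) : set Z2 := range (fun z : Z2 => a + b * z).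

Section Dynamics.
Context {K : realType} {X : metricType K} (f : X -> X).

Definition forward_orbit (x : X) : set X := range (fun n : nat => iter n f x).

Definition periodic (x : X) : Prop := exists2 n, (0 < n)%N & iter n f x = x.

Definition periodic_orbit (C : set X) : Prop :=
  exists2 x, periodic x & C = forward_orbit x.

Definition finite_union_of_balls (A : set X) : Prop :=
  exists2 s : seq (X * K), (forall b, b \in s -> 0 < b.2) &
    A = \bigcup_(b in [set` s]) ball b.1 b.2.

(* Since f maps A to A, the orbit of a point of A is dense in A for the
   subspace topology when its closure in X contains A. *)
Definition minimal_on (A : set X) : Prop :=
  f @` A `<=` A /\ forall x, A x -> A `<=` closure (forward_orbit x).

(* The empty set, on which minimality is vacuous, is excluded. *)
Definition minimal_component (A : set X) : Prop :=
  [/\ A !=set0, clopen A, finite_union_of_balls A & minimal_on A].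

Definition attracted_to (C : set X) (x : X) : Prop :=
  edist_inf C (iter n f x) @[n --> \oo] --> 0%E.

(* The M i, for i in D, are required to be exactly the minimal components of f,
   and P to be exactly the set of its periodic points. *)
Definition minimal_decomposition (P : set X)
    (I : Type) (D : set I) (M : I -> set X) (B : set X) : Prop :=
  let MM := \bigcup_(i in D) M i in
  [/\ [/\ P `|` MM `|` B = setT,
          P `&` MM = set0, P `&` B = set0, MM `&` B = set0 & trivIset D M],
      finite_set P /\ P = [set x | periodic x],
      countable D,
      (forall A, minimal_component A <-> exists2 i, D i & A = M i) &
      forall x, B x -> exists2 C,
        periodic_orbit C \/ minimal_component C & attracted_to C x].

End Dynamics.

(* [fibp A m] is the Fibonacci polynomial F_m over A. *)
Fixpoint fibp (A : nzRingType) (m : nat) : {poly A} :=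
  match m with
  | 0 => 0
  | 1 => 1
  | (m1.+1 as m2).+1 => 'X * fibp A m2 + fibp A m1
  end.

(* c_i in the binary expansion of q *)
Definition bin_digit (q i : nat) : bool := odd (q %/ 2 ^ i).

Fact bin_digit_repeat (q : nat) : exists i, bin_digit q i == bin_digit q i.+1.
Proof.
have q2 : (q < 2 ^ q)%N by exact: ltn_expl.
exists q; rewrite /bin_digit !divn_small//.
by apply: (ltn_trans q2); rewrite ltn_exp2l.
Qed.

Definition t_of (q : nat) : nat := ex_minn (bin_digit_repeat q).

(* Main.v *)
Require Import Defs.
From Stdlib Require Import Rdefinitions.
From mathcomp Require Import Rstruct Rstruct_topology.
From mathcomp Require Import all_boot all_order all_algebra.
From mathcomp Require Import all_classical all_reals all_analysis.
From mathcomp Require Import zify ring.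

Import Order.TTheory GRing.Theory Num.Theory.
Local Open Scope classical_set_scope.
Local Open Scope ring_scope.

(** Write [m = 2k], so that [k = 3 + 6q] and [k - 1 = 2(1 + 3q)].  The number
    [-1/3] has the 2-adic expansion ...010101, and [t(q)] is the last place
    up to which the digits of the odd number [q] agree with it; therefore
    [k - 1 = 2^(t+2) w] with [w] odd ([t_ofE]).

    Two facts about [F = F_m] on the even numbers drive the dynamics.
    - The multiplier is exact: [F x = x (1 + 2^(t+2) u)] with [u] odd, so that
      [F] moves a point of valuation [n] by exactly [2^(n+t+2)].  This comes
      from the doubling formulas for Fibonacci polynomials, which multiply the
      size of the perturbation by 2 at each step ([fibv_even_multiplier]).
    - [F x - F y = (x - y)(1 + 4z)], because [F_2k] is congruent to [k X] modulo
      [X^3] and [k] is 1 modulo 4 ([fibv_even_diff]).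

    For a map with the second property, the displacement of the [j]-th iterate
    is the displacement of the map times [j] times a unit
    ([near_translation_iter_val]), as for a translation.  Hence if [F] moves all
    the points of a coset of [2^N] by [2^N] times a unit, its iterate of order
    [2^s] moves them by [2^(N+s)] times a unit, and the binary digits of a
    target can be reached one at a time: every orbit is dense in the coset
    ([orbit_dense]).  The same identity forbids periodic points other than 0
    ([aperiodic]).

    The sets [M_(n,k)] are exactly the cosets of [2^(n+t+2)] made of numbers of
    valuation [n], so they partition the nonzero even numbers.  Finally 3
    divides [m], so [F] sends odd numbers to even ones, and one step brings any
    point to 0 or into some [M_(n,k)].  This also shows that there are no other
    minimal components: such a component would contain an even point, hence
    coincide with the closure of its orbit, and the closure {0} of the
    orbit of 0 is not open ([minimal_component_is_component]). *)

(** * Values of Fibonacci polynomials *)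

Section FibonacciValues.
Context {R : comNzRingType}.
Implicit Types x y : R.

Definition fibv (m : nat) (x : R) : R := (fibp R m).[x].

Lemma fibv0 x : fibv 0 x = 0. Proof. exact: horner0. Qed.

Lemma fibv1 x : fibv 1 x = 1. Proof. exact: hornerC. Qed.

Lemma fibvSS m x : fibv m.+2 x = x * fibv m.+1 x + fibv m x.
Proof. by rewrite /fibv /= hornerD hornerM hornerX. Qed.

Lemma fibv_add m n x :
  fibv (m + n) x = fibv m x * fibv n.+1 x
                   + (fibv m.+1 x - x * fibv m x) * fibv n x.
Proof.
suff [] : fibv (m + n) x = fibv m x * fibv n.+1 x
                   + (fibv m.+1 x - x * fibv m x) * fibv n x
  /\ fibv (m + n.+1) x = fibv m x * fibv n.+2 x
                   + (fibv m.+1 x - x * fibv m x) * fibv n.+1 x by [].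
elim: n => [|n [IH1 IH2]]; split=> //.
- by rewrite addn0 fibv0 fibv1; ring.
- by rewrite addn1 fibvSS fibv0 fibv1; ring.
- by rewrite 2!addnS fibvSS -addnS IH1 IH2 !fibvSS; ring.
Qed.

Lemma fibvS_add m n x :
  fibv (m + n).+1 x = fibv m.+1 x * fibv n.+1 x + fibv m x * fibv n x.
Proof. by rewrite -addSn fibv_add fibvSS; ring. Qed.

(** With [e = 2^s (2y)], the pair [(F_N, F_(N+1))] for [N = 2^(s+1)] is
    [(e u, 1 + e b)] with [u] odd.  The formulas
    [F_2N = F_N (2 F_(N+1) - x F_N)] and [F_(2N+1) = F_(N+1)^2 + F_N^2] preserve
    this shape while doubling [e]; evenness of [x = 2y] keeps [u] odd. *)
Lemma fibv_pow2 s y : exists a b,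
  fibv (2 ^ s.+1) (2 * y) = 2 ^+ s * (2 * y) * (1 + 2 * a) /\
  fibv (2 ^ s.+1).+1 (2 * y) = 1 + 2 ^+ s * (2 * y) * b.
Proof.
elim: s => [|s [a [b [e1 e2]]]].
  exists 0, (2 * y); rewrite expn1 !fibvSS fibv0 fibv1 expr0.
  by split; ring.
rewrite expnS mul2n -addnn fibv_add fibvS_add e1 e2.
set f := 2 ^+ s; rewrite exprS -/f.
exists (a + (f * y * b - y * (f * y) * (1 + 2 * a)) * (1 + 2 * a)).
exists (b + f * y * (b ^+ 2 + (1 + 2 * a) ^+ 2)).
by split; ring.
Qed.

(** Passing from the index [N] to [wN] is linear to first order: [F_N] gets
    multiplied by [w] up to an even correction. *)
Lemma fibv_pow2_mul s w y : exists c b,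
  fibv (2 ^ s.+1 * w) (2 * y) = 2 ^+ s * (2 * y) * (w%:R + 2 * c) /\
  fibv (2 ^ s.+1 * w).+1 (2 * y) = 1 + 2 ^+ s * (2 * y) * b.
Proof.
have [a [b' [e1 e2]]] := fibv_pow2 s y.
elim: w => [|w [c [b [e3 e4]]]].
  by exists 0, 0; rewrite muln0 fibv0 fibv1; split; ring.
rewrite mulnS addnC fibv_add fibvS_add e1 e2 e3 e4.
set f := 2 ^+ s.
exists (c + f * y * b' * (w%:R + 2 * c) + a
   + (f * y * b - 2 * y * f * y * (w%:R + 2 * c)) * (1 + 2 * a)).
exists (b + b' + f * (2 * y) * (b * b' + (w%:R + 2 * c) * (1 + 2 * a))).
by split; ring.
Qed.

(** The index [2 + 2^(v+1) w] is twice [1 + 2^v w], and [F_2k] has derivative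
    [k] at 0: the statement says that at even points the multiplier is this
    derivative, up to higher powers of 2. *)
Lemma fibv_even_multiplier v w y : odd w -> exists c,
  fibv (2 + 2 ^ v.+1 * w) (2 * y) = 2 * y * (1 + 2 ^+ v * (1 + 2 * c)).
Proof.
move=> wodd; have [c [b [e1 e2]]] := fibv_pow2_mul v w y.
rewrite add2n fibvSS e1 e2 -(odd_double_half w) wodd -mul2n natrD natrM.
by exists (w./2%:R + c + y * b); rewrite /=; ring.
Qed.

Lemma fibv_even_parity k y : exists g h,
  fibv k.*2 (2 * y) = 2 * g /\ fibv k.*2.+1 (2 * y) = 1 + 4 * h.
Proof.
elim: k => [|k [g [h [e1 e2]]]].
  by exists 0, 0; rewrite fibv0 fibv1; split; ring.
rewrite doubleS !fibvSS e1 e2.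
exists (y * (1 + 4 * h) + g), (h + y * (y * (1 + 4 * h) + g)).
by split; ring.
Qed.

(** The derivative of [F_2k] is congruent to [k] modulo 4 at even points, since
    [F_2k - k X] is divisible by [X^3]; this is the finite difference form of
    that fact.  The induction carries along [F_(2k+1)], whose differences are
    even multiples of [x - y]. *)
Lemma fibv_even_diff k x y : exists z,
  fibv k.*2 (2 * x) - fibv k.*2 (2 * y) = (2 * x - 2 * y) * (k%:R + 4 * z).
Proof.
suff [z [z' []]] : exists z z',
  fibv k.*2 (2 * x) - fibv k.*2 (2 * y) = (2 * x - 2 * y) * (k%:R + 4 * z) /\
  fibv k.*2.+1 (2 * x) - fibv k.*2.+1 (2 * y) = (2 * x - 2 * y) * (2 * z').
  by exists z.
elim: k => [|k [z [z' [/(canRL (subrK _)) e1 /(canRL (subrK _)) e2]]]].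
  by exists 0, 0; rewrite !fibv0 !fibv1; split; ring.
have [g [h [e3 e4]]] := fibv_even_parity k y.
rewrite doubleS !fibvSS e1 e2 e3 e4.
exists (z + x * z' + h).
exists (x * (k.+1%:R + 4 * (z + x * z' + h)) + y * (1 + 4 * h) + g + z').
by split; rewrite -natr1; ring.
Qed.

(** Modulo 2 the polynomials at 1 are the Fibonacci numbers 0, 1, 1, 0, 1, 1, ... *)
Lemma fibv3_odd k y : exists z, fibv (3 * k) (1 + 2 * y) = 2 * z.
Proof.
suff [z []] : exists z, fibv (3 * k) (1 + 2 * y) = 2 * z /\
                exists z', fibv (3 * k).+1 (1 + 2 * y) = 1 + 2 * z' by exists z.
elim: k => [|k [z [e1 [z' e2]]]].
  by exists 0; rewrite muln0 fibv0 fibv1; split; last exists 0; ring.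
rewrite mulnS addnC addn3 !fibvSS e1 e2.
set Z := (1 + 2 * y + 2 * y ^+ 2) * (1 + 2 * z') + (1 + 2 * y) * z.
exists Z; split; first by rewrite /Z; ring.
by exists ((1 + 2 * y) * Z + y + z' + 2 * y * z' + z); rewrite /Z; ring.
Qed.

End FibonacciValues.

(** * Maps whose difference quotients are 1 modulo 4 *)

Section NearTranslations.
Context {R : comNzRingType}.
Implicit Types (x y : R) (g : R -> R).

Definition evens : set R := range (fun y : R => 2 * y).

(** Only even points matter, because the difference quotients of a polynomial
    such as [F_2k] are controlled there alone. *)
Definition near_translation g :=
  (forall x, evens x -> evens (g x)) /\
  (forall x y, evens x -> evens y ->
     exists z, g x - g y = (x - y) * (1 + 4 * z)).

Lemma near_translation_comp g :
  near_translation g -> near_translation (g \o g).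
Proof.
move=> [gE gD]; split=> [x /gE /gE//|x y Ex Ey /=].
have [z e1] := gD _ _ Ex Ey; have [z' e2] := gD _ _ (gE _ Ex) (gE _ Ey).
by rewrite e2 e1; exists (z + z' + 4 * z * z'); ring.
Qed.

Lemma iter_evens {g} : near_translation g ->
  forall j x, evens x -> evens (iter j g x).
Proof. by move=> [gE _]; elim=> [//|j IH] x /IH /gE. Qed.

(** Each further step adds the displacement [g x - x], up to a factor that is 1
    modulo 4. *)
Lemma near_translation_iter {g} (gN : near_translation g) j x : evens x ->
  exists z, iter j g x - x = (g x - x) * (j%:R + 4 * z).
Proof.
move=> Ex; elim: j => [|j [z e]]; first by exists 0; rewrite /=; ring.
have [z' e'] := gN.2 _ _ (iter_evens gN j _ Ex) Ex.
rewrite iterS -(subrKA (g x)) e' e -natr1.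
by exists (z + z' * (j%:R + 4 * z)); ring.
Qed.

(** For odd [j] the factor [j + 4z] is odd.  The general case follows by
    induction on [s], replacing [g] by its square: the displacement of the
    square is [2 + 4z] times that of [g]. *)
Lemma near_translation_iter_val {g} (gN : near_translation g) s j x :
  evens x -> odd j ->
  exists u, iter (j * 2 ^ s) g x - x = 2 ^+ s * (1 + 2 * u) * (g x - x).
Proof.
move=> Ex jodd; elim: s g gN => [|s IH] g gN.
  have [z e] := near_translation_iter gN j _ Ex.
  rewrite muln1 e -(odd_double_half j) jodd -mul2n natrD natrM.
  by exists (j./2%:R + 2 * z); rewrite /=; ring.
have [u e] := IH _ (near_translation_comp _ gN).
have [z e'] := near_translation_iter gN 2 _ Ex.
have -> : iter (j * 2 ^ s.+1) g x = iter (j * 2 ^ s) (g \o g) x.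
  by rewrite expnSr mulnA iterM.
rewrite e /= -[g (g x)]/(iter 2 g x) e'.
by exists (u + z + 2 * u * z); rewrite exprS; ring.
Qed.

End NearTranslations.

(** * Division by powers of 2 in the 2-adic integers *)

Section Z2Arithmetic.
Implicit Types (x y z : Z2).

Lemma res_nat k n : res (k%:R) n = (k%:Z %% 2 ^+ n)%Z.
Proof.
elim: k => [|k IH]; first by rewrite mulr0n res0 mod0z.
rewrite -natr1 resD IH -[res 1 n]/((1 %% 2 ^+ n)%Z) modzDm.
by congr (_ %% _)%Z; lia.
Qed.

Lemma res_mul2 y n : res (2 * y) n = ((2 * res y n) %% 2 ^+ n)%Z.
Proof. by rewrite -[res (2 * y) n]/((res 2%R n * res y n) %% 2 ^+ n)%Z
  res_nat modzMml. Qed.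

Lemma res_mul2_eq0 y n : res (2 * y) n.+1 = 0 <-> res y n = 0.
Proof.
have e : (2 : int) != 0 by [].
rewrite res_mul2 exprS -(resP y n); split=> /dvdz_mod0P h; apply/dvdz_mod0P.
  by move: h; rewrite dvdz_mul2l.
by rewrite dvdz_mul2l.
Qed.

Fact half_subproof x n :
  ((res x n.+2 %/ 2)%Z %% 2 ^+ n)%Z = (res x n.+1 %/ 2)%Z.
Proof.
have p : (0 < 2 ^+ n.+1 :> int) by rewrite exprn_gt0.
have b0 : 0 <= res x n.+1 by rewrite -resP modz_ge0// gt_eqF.
have b1 : res x n.+1 < 2 ^+ n.+1 by rewrite -resP ltz_pmod.
rewrite (divz_eq (res x n.+2) (2 ^+ n.+1)) resP [2 ^+ n.+1]exprSr mulrA.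
rewrite divzMDl// modzMDl modz_small// divz_ge0// b0 /=.
by rewrite ltz_divLR// -exprSr.
Qed.

(** The floor of [x / 2], that is the shift of the binary digits. *)
Definition half x : Z2 := MkZ2 (half_subproof x).

Lemma half_even x : res x 1 = 0 -> x = 2 * half x.
Proof.
move=> x1; apply: Z2_ext => n; rewrite res_mul2 /=.
suff : (2 %| res x n.+1)%Z by move=> /divzK; rewrite mulrC => ->; rewrite resP.
elim: n => [|n IH]; first by rewrite x1.
rewrite (divz_eq (res x n.+2) (2 ^+ n.+1)) resP rpredD//.
by rewrite dvdz_mull// exprS dvdz_mulr.
Qed.

Lemma mul2_inj x y : 2 * x = 2 * y -> x = y.
Proof.
move=> e; apply/subr0_eq/Z2_ext => n; rewrite res0; apply/res_mul2_eq0.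
by rewrite mulrBr e subrr res0.
Qed.

Lemma pow2_inj n x y : 2 ^+ n * x = 2 ^+ n * y -> x = y.
Proof.
elim: n => [|n IH]; first by rewrite expr0 !mul1r.
by rewrite exprS -!mulrA => /mul2_inj /IH.
Qed.

Lemma even_or_odd x : (exists y, x = 2 * y) \/ (exists y, x = 1 + 2 * y).
Proof.
have [/half_even xE|x1] := eqVneq (res x 1) 0.
  by left; eexists; exact: xE.
right; exists (half (x - 1)); rewrite -half_even; first by rewrite addrC subrK.
rewrite resD resN -[res 1 1]/(1 : int).
have : 0 <= res x 1 < 2 by rewrite -res_mod modz_ge0// ltz_pmod.
by move: x1; case: (res x 1) => [[|[|k]]|].
Qed.

Lemma odd_neq_even x y : 1 + 2 * x <> 2 * y.
Proof.
move=> /(congr1 (fun z => res z 1)); rewrite resD !res_mul2 !expr1.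
by rewrite -[res 1 1]/(1 : int) !modzMr.
Qed.

Lemma res_pow2_mul n y : res (2 ^+ n * y) n = 0.
Proof.
elim: n y => [|n IH] y; first by rewrite res_at0.
by rewrite exprS -mulrA; apply/res_mul2_eq0.
Qed.

Lemma coset2P a n x : coset2 a (2 ^+ n) x <-> res (x - a) n = 0.
Proof.
split=> [[z _ <-]|]; first by rewrite [a + _]addrC addrK res_pow2_mul.
rewrite -{2}[x](subrKC a); elim: n (x - a) => [|n IH] y yn.
  by exists y => //; rewrite expr0 mul1r.
have e : y = 2 * half y by apply/half_even/(res_eq0_le _ yn).
move: yn; rewrite e => /res_mul2_eq0 /IH [z _ /addrI <-].
by exists z => //; rewrite exprS mulrA.
Qed.

Lemma pow2_odd_decomposition x : x != 0 -> exists n u, x = 2 ^+ n * (1 + 2 * u).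
Proof.
move=> /Z2_neq0_ex [n]; elim: n x => [|n IH] x.
  have [[y ->]|[u ->] _] := even_or_odd x.
    by rewrite (res_pow2_mul 1).
  by exists 0%N, u; rewrite expr0 mul1r.
have [[y ->]|[u ->] _] := even_or_odd x; last first.
  by exists 0%N, u; rewrite expr0 mul1r.
move=> /eqP h; have /IH [k [u ->]] : res y n.+1 != 0.
  by apply/eqP => /res_mul2_eq0.
by exists k.+1, u; rewrite exprS mulrA.
Qed.

Lemma pow2_odd_inj n n' (u u' : Z2) :
  2 ^+ n * (1 + 2 * u) = 2 ^+ n' * (1 + 2 * u') -> n = n' /\ u = u'.
Proof.
wlog le : n n' u u' / (n <= n')%N.
  move=> H e; have [l|/ltnW l] := leqP n n'; first exact: H.
  by have [] := H _ _ _ _ l (esym e).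
rewrite -(subnKC le); case: (n' - n)%N => [|k].
  by rewrite addn0 => /pow2_inj /addrI /mul2_inj.
by rewrite exprD -mulrA => /pow2_inj; rewrite exprS -mulrA => /odd_neq_even.
Qed.

End Z2Arithmetic.

(** * Orbits of near translations *)

Section OrbitDensity.
Implicit Types (x y : Z2) (g : Z2 -> Z2).

(** The digits of the target are corrected one at a time.  If [g^i x] agrees
    with [y] modulo [2^(N+s)] but not modulo [2^(N+s+1)], then [2^s] further
    steps add an odd multiple of [2^(N+s)], which repairs the digit without
    changing the lower ones. *)
Lemma orbit_dense {g} (gN : near_translation g) N x :
  (forall y, coset2 x (2 ^+ N) y ->
     evens y /\ exists a, g y = y + 2 ^+ N * (1 + 2 * a)) ->
  forall y, coset2 x (2 ^+ N) y ->
  forall s, exists i, coset2 y (2 ^+ (N + s)) (iter i g x).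
Proof.
move=> step y xy.
have stay i : coset2 x (2 ^+ N) (iter i g x).
  elim: i => [|i IH]; first by exists 0 => //=; rewrite mulr0 addr0.
  have [_ [a e]] := step _ IH; case: IH => z _ ez.
  by rewrite iterS e -ez; exists (z + (1 + 2 * a)) => //; ring.
elim=> [|s [i [e _ ei]]].
  exists 0%N; rewrite addn0; case: xy => z _ <-.
  by exists (- z) => //=; ring.
have [[e' ee]|[e' ee]] := even_or_odd e.
  by exists i; rewrite -ei ee; exists e' => //; rewrite addnS exprS; ring.
have [Ez [a ea]] := step _ (stay i).
have [u /(canRL (subrK _)) eu] := near_translation_iter_val gN s 1 _ Ez isT.
exists (1 * 2 ^ s + i)%N; rewrite iterD eu ea -ei ee.
exists (1 + e' + u + a + 2 * u * a) => //.
by rewrite addnS exprS exprD; ring.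
Qed.

(** The [n]-th iterate displaces [x] by [n] times a unit times [g x - x], and
    this does not vanish. *)
Lemma aperiodic {g} (gN : near_translation g) N x a : evens x ->
  g x = x + 2 ^+ N * (1 + 2 * a) -> ~ Defs.periodic g x.
Proof.
move=> Ex ea [n n0 per].
have [s [j [jodd en]]] : exists s j, odd j /\ n = (j * 2 ^ s)%N.
  have [j j2 en] := pfactor_coprime (p := 2) isT n0.
  by exists (logn 2 n), j; rewrite -coprime2n.
have [u] := near_translation_iter_val gN s j _ Ex jodd.
rewrite -en per ea subrr => e.
(* The vanishing displacement is written as that power of 2 times 2 * 0, so that
   cancelling leaves a parity contradiction. *)
have : 2 ^+ (s + N) * (1 + 2 * (u + a + 2 * u * a)) = 2 ^+ (s + N) * (2 * 0).
  rewrite !mulr0 [RHS]e exprD; ring.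
by move=> /pow2_inj /odd_neq_even.
Qed.

End OrbitDensity.

(** * The 2-adic topology in terms of cosets *)

Section Z2Topology.
Implicit Types (x y a : Z2) (A : set Z2).

Lemma coset2_refl a b : coset2 a b a.
Proof. by exists 0 => //; rewrite mulr0 addr0. Qed.

Lemma coset2_sym a b x : coset2 a b x -> coset2 x b a.
Proof. by case=> z _ <-; exists (- z) => //; ring. Qed.

Lemma coset2_trans a b x y : coset2 a b x -> coset2 x b y -> coset2 a b y.
Proof. by move=> [z _ <-] [z' _ <-]; exists (z + z') => //; ring. Qed.

Lemma coset2_eq a b x : coset2 a b x -> coset2 a b = coset2 x b.
Proof.
move=> ax; apply/seteqP; split=> y; last exact: coset2_trans.
by apply: coset2_trans; exact: coset2_sym.
Qed.

(** Distances are powers of 2, so being less than [2 2^-n] is the same as being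
    at most [2^-n]. *)
Lemma coset2_ball x n : coset2 x (2 ^+ n) = ball x ((2 * 2 ^- n)%R : R).
Proof.
rewrite ballEmdist; apply/seteqP; split=> y; rewrite coset2P.
  move=> /eqP h; rewrite /= -[mdist x y]/(dist2 x y) dist2C /dist2.
  move: h; rewrite -abs2_le => /le_lt_trans; apply.
  by rewrite ltr_pMl ?ltr1n// invr_gt0 exprn_gt0.
move=> xy; have : abs2 (y - x) < 2 * 2 ^- n.
  by rewrite -/(dist2 y x) dist2C; exact: xy.
move=> {xy} h; apply/eqP; rewrite -abs2_le; move: h.
rewrite /abs2; case: ifP => [_ _|_]; first by rewrite invr_ge0 exprn_ge0.
rewrite ltr_pdivlMr ?exprn_gt0// mulrC ltr_pdivrMr ?exprn_gt0// -exprS.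
by rewrite ltr_eXn2l ?ltr1n// ltnS lef_pV2 ?posrE ?exprn_gt0// ler_eXn2l ?ltr1n.
Qed.

Lemma nbhs_coset2P x A : nbhs x A <-> exists n, coset2 x (2 ^+ n) `<=` A.
Proof.
split=> [/nbhs_ballP [e /= e0 eA]|[n nA]]; last first.
  apply/nbhs_ballP; exists ((2 * 2 ^- n)%R : R); last by rewrite -coset2_ball.
  by rewrite /= mulr_gt0 ?invr_gt0 ?exprn_gt0.
have [n hn] : exists n, 2 * 2 ^- n <= e.
  exists (Num.bound (2 / e)).
  rewrite ler_pdivrMr ?exprn_gt0// mulrC -ler_pdivrMr//.
  apply/ltW; apply: (lt_le_trans (archi_boundP _)).
    by rewrite divr_ge0 ?ltW.
  by rewrite -natrX ler_nat ltnW// ltn_expl.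
by exists n; rewrite coset2_ball => y /(le_ball hn) /eA.
Qed.

Lemma closure_coset2P A x :
  closure A x <-> forall n, exists y, A y /\ coset2 x (2 ^+ n) y.
Proof.
split=> [xA n|h B /nbhs_coset2P [n nB]].
  by apply: xA; apply/nbhs_coset2P; exists n.
by have [y [Ay /nB By]] := h n; exists y.
Qed.

Lemma coset2_clopen a n : clopen (coset2 a (2 ^+ n)).
Proof.
split.
  rewrite openE => x ax; rewrite /interior; apply/nbhs_coset2P; exists n => y.
  exact: coset2_trans.
move=> x /closure_coset2P /(_ n) [y [ay xy]].
exact: (coset2_trans _ _ _ _ ay (coset2_sym _ _ _ xy)).
Qed.

Lemma coset2_finite_union_of_balls a n :
  finite_union_of_balls (coset2 a (2 ^+ n)).
Proof.
exists [:: (a, (2 * 2 ^- n)%R : R)].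
  by move=> b; rewrite inE => /eqP ->; rewrite /= mulr_gt0 ?invr_gt0 ?exprn_gt0.
apply/seteqP; split=> [y|y [b /=]]; last by rewrite inE coset2_ball => /eqP ->.
by rewrite coset2_ball => ay; exists (a, 2 * 2 ^- n) => //=; rewrite inE.
Qed.

End Z2Topology.

Lemma attracted_to_entered (f : Z2 -> Z2) (C : set Z2) x :
  (forall n, C (iter n.+1 f x)) -> attracted_to f C x.
Proof.
move=> h; rewrite /attracted_to; apply: cvg_near_cst.
by exists 1%N => // -[//|n] _ /=; apply: edist_inf0; exact: (h n).
Qed.

(** * The function t *)

Lemma bin_digitE q i : (q %% 2 ^ i.+1 = q %% 2 ^ i + bin_digit q i * 2 ^ i)%N.
Proof.
rewrite /bin_digit -modn2; set a := (q %/ 2 ^ i)%N.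
have r_lt : (q %% 2 ^ i < 2 ^ i)%N by rewrite ltn_mod expn_gt0.
have a_lt : (a %% 2 < 2)%N by rewrite ltn_mod.
have -> : (q %% 2 ^ i.+1)%N
        = ((a %/ 2 * 2 ^ i.+1 + (q %% 2 ^ i + a %% 2 * 2 ^ i)) %% 2 ^ i.+1)%N.
  congr modn; rewrite {1}(divn_eq q (2 ^ i)) -/a {1}(divn_eq a 2) expnS; lia.
rewrite modnMDl modn_small// expnS.
by case: (a %% 2)%N a_lt => [|[|]]//; lia.
Qed.

(** As long as the digits [c_0 = 1, ..., c_i] alternate, the residue [r] of [q]
    modulo [2^(i+1)] is that of [-1/3], whence [3r + 1 = 2^(i+1) (1 + c_i)].  At
    [i = t] the next digit repeats [c_t], and writing
    [q = r + 2^(t+1) Q] with [Q] of the parity of [c_t] gives the cofactor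
    [1 + c_t + 3Q], which is odd. *)
Lemma t_ofE q : odd q -> exists2 w, odd w & (1 + 3 * q = 2 ^ (t_of q).+1 * w)%N.
Proof.
move=> qodd; rewrite /t_of; case: ex_minnP => t /eqP tq tmin.
have alt i : (i <= t)%N ->
  (3 * (q %% 2 ^ i.+1) + 1 = 2 ^ i.+1 * (1 + bin_digit q i))%N.
  elim: i => [_|i IH it].
    by rewrite expn1 /bin_digit expn0 divn1 modn2 qodd.
  have ne : bin_digit q i != bin_digit q i.+1.
    by apply/negP => /tmin; lia.
  rewrite bin_digitE; have := IH (ltnW it); rewrite (expnS 2 i.+1).
  by move: ne; case: bin_digit; case: bin_digit => //= _; lia.
have := alt t (leqnn t); set r := (q %% _)%N => er.
have := divn_eq q (2 ^ t.+1); rewrite -/r => eq.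
have ed : bin_digit q t.+1 = odd (q %/ 2 ^ t.+1) by [].
exists (1 + bin_digit q t + 3 * (q %/ 2 ^ t.+1))%N.
  by rewrite oddD oddM -ed -tq; case: bin_digit.
by rewrite [q in LHS]eq; move: er; lia.
Qed.

(** * The cosets partitioning the nonzero even numbers *)

Section Components.
Variable t : nat.

Definition component (nk : nat * nat) : set Z2 :=
  coset2 ((1 + 2 * nk.2)%:R * 2 ^+ nk.1) (2 ^+ (nk.1 + t + 2)).

Definition component_index : set (nat * nat) :=
  [set nk | (1 <= nk.1)%N /\ (nk.2 <= 2 ^ (t + 1) - 1)%N].

Lemma evens_pow2 n (x : Z2) : (0 < n)%N -> evens (2 ^+ n * x).
Proof.
by case: n => // n _; exists (2 ^+ n * x); rewrite // mulrA -exprS.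
Qed.

Lemma pow2_int n : (2 : int) ^+ n = (2 ^ n)%N.
Proof. by rewrite -natrX natz. Qed.

Lemma component_form n k x : component (n, k) x -> exists z,
  x = 2 ^+ n * (1 + 2 * (k%:R + 2 ^+ t.+1 * z)).
Proof.
move=> [z _ <-]; exists z.
by rewrite /= natrD natrM -addnA exprD addn2 (exprS _ t.+1); ring.
Qed.

Lemma component_uniq nk nk' x :
  component_index nk -> component_index nk' ->
  component nk x -> component nk' x -> nk = nk'.
Proof.
have small k : (k <= 2 ^ (t + 1) - 1)%N -> (k %% 2 ^ t.+1 = k)%N.
  by move=> h; rewrite modn_small//; move: h; rewrite addn1 leq_subRL ?expn_gt0.
case: nk nk' => [n k] [n' k'] [/= _ kD] [/= _ kD'].
move=> /component_form [z ->] /component_form [z'].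
move=> /pow2_odd_inj [-> e]; congr pair.
rewrite -(small _ kD) -(small _ kD').
have := congr1 (fun y => res y t.+1) e.
rewrite !resD !res_pow2_mul !addr0 !res_mod !res_nat.
by rewrite pow2_int !modz_nat => -[].
Qed.

(** If [x = 2^n (1 + 2u)], then [k] is the residue of [u] modulo [2^(t+1)]. *)
Lemma component_cover x : evens x -> x != 0 ->
  exists2 nk, component_index nk & component nk x.
Proof.
move=> [y _ <-] x0; have [n [u e]] := pow2_odd_decomposition _ x0.
case: n e => [|n] e.
  by move: e; rewrite expr0 mul1r => /esym /odd_neq_even.
pose k := `|res u t.+1|%N.
have uge0 : 0 <= res u t.+1 by rewrite -res_mod modz_ge0// gt_eqF// exprn_gt0.
have ult : res u t.+1 < 2 ^+ t.+1 by rewrite -res_mod ltz_pmod// exprn_gt0.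
have kE : k%:Z = res u t.+1 by rewrite /k gez0_abs.
exists (n.+1, k).
  split=> //=; rewrite addn1.
  have : (k < 2 ^ t.+1)%N by rewrite -ltz_nat kE -pow2_int.
  lia.
have /coset2P [z _ uE] : res (u - k%:R) t.+1 = 0.
  by apply/eqP; rewrite resB_eq0 res_nat kE res_mod.
exists z => //.
by rewrite e -uE /= natrD natrM -addnA exprD addn2 (exprS _ t.+1); ring.
Qed.

Lemma component_evens nk x : component_index nk -> component nk x -> evens x.
Proof.
case: nk => n k [/= n0 _] /component_form [z ->]; exact: evens_pow2.
Qed.

Lemma component_neq0 nk : ~ component nk 0.
Proof.
case: nk => n k /component_form [z].
rewrite -[LHS](mulr0 (2 ^+ n)) => /pow2_inj.
by rewrite -[LHS](mulr0 2) => /esym /odd_neq_even.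
Qed.

Lemma component_closed nk : closed (component nk).
Proof. exact: (coset2_clopen _ _).2. Qed.

End Components.

(** * Dynamics of a near translation with an exact multiplier *)

Section MinimalComponents.
Variables (t : nat) (F : Z2 -> Z2).
Hypothesis F_near_translation : near_translation F.
Hypothesis F_even : forall y : Z2, exists c,
  F (2 * y) = 2 * y * (1 + 2 ^+ t.+2 * (1 + 2 * c)).
Hypothesis F_odd : forall u : Z2, evens (F (1 + 2 * u)).

Local Notation M := (component t).
Local Notation D := (component_index t).

Lemma map0 : F 0 = 0.
Proof. by have [c] := F_even 0; rewrite mulr0 mul0r. Qed.

Lemma map_even_step n (u : Z2) : (0 < n)%N -> exists a,
  F (2 ^+ n * (1 + 2 * u))
  = 2 ^+ n * (1 + 2 * u) + 2 ^+ (n + t + 2) * (1 + 2 * a).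
Proof.
case: n => // n _; have [c e] := F_even (2 ^+ n * (1 + 2 * u)).
exists (u + c + 2 * u * c).
by rewrite exprS -mulrA e addn2 addSn !exprS exprD; ring.
Qed.

Lemma component_dense n k x : D (n, k) -> M (n, k) x ->
  M (n, k) `<=` closure (forward_orbit F x).
Proof.
move=> [/= n0 _] Mx y My; have [z xE] := component_form _ _ _ _ Mx.
move: My; rewrite /component (coset2_eq _ _ _ Mx) /= => My.
apply/closure_coset2P => s.
have step w : coset2 x (2 ^+ (n + t + 2)) w ->
    evens w /\ exists a, F w = w + 2 ^+ (n + t + 2) * (1 + 2 * a).
  move=> xw; have /component_form [z' ->] := coset2_trans _ _ _ _ Mx xw.
  by split; [exact: evens_pow2|exact: map_even_step].
have [i [e _ ei]] := orbit_dense F_near_translation _ _ step _ My s.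
exists (iter i F x); split; first by exists i.
by exists (2 ^+ (n + t + 2) * e) => //; rewrite -ei [in RHS]exprD; ring.
Qed.

Lemma component_stable nk x : D nk -> M nk x -> M nk (F x).
Proof.
case: nk => n k [/= n0 _] Mx; have [z xE] := component_form _ _ _ _ Mx.
have [a e] := map_even_step n (k%:R + 2 ^+ t.+1 * z) n0.
apply: (coset2_trans _ _ _ _ Mx); rewrite xE e.
by exists (1 + 2 * a).
Qed.

Lemma component_minimal nk : D nk -> minimal_component F (M nk).
Proof.
move=> Dnk; split; [|exact: coset2_clopen|exact: coset2_finite_union_of_balls|].
- by eexists; exact: coset2_refl.
split=> [_ [x Mx <-]|x Mx]; first exact: component_stable.
by case: nk Dnk Mx => n k; exact: component_dense.
Qed.

(** All iterates are even, so an odd point never returns to itself. *)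
Lemma periodic_only0 : [set 0] = [set x | Defs.periodic F x].
Proof.
apply/seteqP; split=> [_ ->|x]; first by exists 1%N => //=; rewrite map0.
rewrite /Defs.periodic /= => xP.
have [//|x0] := eqVneq x 0.
have Ex : evens x.
  have [[y ->]|[u xE]] := even_or_odd x; first by exists y.
  case: xP => -[//|n] _; rewrite iterSr xE => e.
  have [y _] := iter_evens F_near_translation n _ (F_odd u).
  by rewrite e => /esym /odd_neq_even.
have [[n k] [/= n0 _] /component_form [z xE]] := component_cover t _ Ex x0.
have [a e] := map_even_step n (k%:R + 2 ^+ t.+1 * z) n0.
case: (aperiodic F_near_translation (n + t + 2) x a Ex _ xP).
by rewrite xE.
Qed.

Lemma map_hits_component x : F x = 0 \/ exists2 nk, D nk & M nk (F x).
Proof.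
have Ex : evens (F x).
  have [[y ->]|[u ->]] := even_or_odd x; last exact: F_odd.
  by apply: F_near_translation.1; exists y.
by have [->|/(component_cover t _ Ex)] := eqVneq (F x) 0; [left|right].
Qed.

Lemma orbit_sub (A : set Z2) x :
  F @` A `<=` A -> A x -> forward_orbit F x `<=` A.
Proof.
move=> FA Ax _ [i _ <-]; elim: i => //= i IH.
by apply: FA; exists (iter i F x).
Qed.

(** A minimal component contains the image of one of its points, which is 0 or
    lies in some [M_(n,k)].  In the latter case both sets are the closure of the
    orbit of that image. *)
Lemma minimal_component_is_component A : minimal_component F A ->
  exists2 nk, D nk & A = M nk.
Proof.
move=> [[x Ax] [Ao Ac] _ [FA Adense]].
have AFx : A (F x) by apply: FA; exists x.
have [F0x|[nk Dnk MFx]] := map_hits_component x.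
  (* The orbit of 0 is {0}; it is not dense in the open set A, which contains
     a power of 2. *)
  have [n nA] : exists n, coset2 0 (2 ^+ n) `<=` A.
    apply/nbhs_coset2P; move: AFx; rewrite F0x.
    by move: Ao; rewrite openE; apply.
  have A2 : A (2 ^+ n) by apply: nA; exists 1 => //; rewrite mulr1 add0r.
  move: AFx; rewrite F0x => /Adense /(_ _ A2) /closure_coset2P /(_ n.+1).
  move=> [_ [[i _ <-] [z _]]].
  have -> : iter i F 0 = 0 by elim: i => //= i ->; exact: map0.
  move=> e; have : 2 ^+ n * (1 + 2 * z) = 2 ^+ n * (2 * 0).
    by rewrite !mulr0 -e exprS; ring.
  by move=> /pow2_inj /odd_neq_even.
exists nk => //; apply/seteqP; split=> y.
  move=> /(Adense _ AFx) => yc; apply: component_closed.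
  apply: closure_subset yc; apply: orbit_sub => // _ [w Mw <-].
  exact: component_stable.
case: nk Dnk MFx => n k Dnk MFx /(component_dense _ _ _ Dnk MFx) yc.
by apply: Ac; apply: closure_subset yc; exact: orbit_sub.
Qed.

Lemma attracted_in_one_step x : attracted_to F [set 0] x \/
  exists2 nk, D nk & attracted_to F (M nk) x.
Proof.
have [F0x|[nk Dnk MFx]] := map_hits_component x; [left|right; exists nk => //].
all: apply: attracted_to_entered => n; rewrite iterSr.
  by rewrite F0x; elim: n => //= n ->; exact: map0.
by elim: n => //= n; exact: component_stable.
Qed.

End MinimalComponents.

(** * The Fibonacci polynomials of index 6 + 12 q *)

Section FibonacciDynamics.
Variable q : nat.
Local Notation F := (@fibv Z2 (6 + 12 * q)).

Lemma fib_odd (u : Z2) : evens (F (1 + 2 * u)).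
Proof.
have [z e] := fibv3_odd (2 + 4 * q) u; exists z => //.
by rewrite -e; congr fibv; lia.
Qed.

Hypothesis q_odd : odd q.

Lemma fib_near_translation : near_translation F.
Proof.
have F2 x : F x = fibv (3 + 6 * q).*2 x by congr fibv; lia.
split=> [_ [y _ <-]|_ _ [x _ <-] [y _ <-]]; rewrite !F2.
  by have [g [_ [-> _]]] := fibv_even_parity (3 + 6 * q) y; exists g.
have [z ->] := fibv_even_diff (3 + 6 * q) x y.
exists (2 + 3 * q./2%:R + z).
have -> : (3 + 6 * q = 1 + 4 * (2 + 3 * q./2))%N.
  by rewrite -{1}(odd_double_half q) q_odd; lia.
by rewrite !(natrD, natrM); ring.
Qed.

Let t := t_of q.

Lemma fib_even (y : Z2) : exists c,
  F (2 * y) = 2 * y * (1 + 2 ^+ t.+2 * (1 + 2 * c)).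
Proof.
have [w wodd ew] := t_ofE q q_odd.
have em : (6 + 12 * q = 2 + 2 ^ t.+3 * w)%N.
  by rewrite (expnS 2 t.+2) (expnS 2 t.+1) -!mulnA -ew; lia.
by have [c e] := @fibv_even_multiplier Z2 t.+2 w y wodd; exists c; rewrite em.
Qed.

End FibonacciDynamics.

Theorem theorem7p5 (d q m : nat)
    (hq : q = (1 + 2 * d)%N) (hm : m = (6 + 12 * q)%N) :
  let t := t_of q in
  let F : Z2 -> Z2 := fun x => (fibp Z2 m).[x] in
  let D := [set nk : nat * nat | (1 <= nk.1)%N /\ (nk.2 <= 2 ^ (t + 1) - 1)%N] in
  let M := fun nk : nat * nat =>
    coset2 ((1 + 2 * nk.2)%:R * 2 ^+ nk.1) (2 ^+ (nk.1 + t + 2)) in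
  let B := coset2 1 2 in
  [/\ minimal_decomposition F [set 0] D M B,
      F 0 = 0,
      clopen B &
      forall x, B x ->
        attracted_to F [set 0] x \/
        exists2 nk, D nk & attracted_to F (M nk) x].
Proof.
rewrite hm => t F D M B.
have q_odd : odd q by rewrite hq oddD oddM.
have Fnt : near_translation F := fib_near_translation q q_odd.
have Fev := fib_even q q_odd.
have Fodd := fib_odd q.
have F0 : F 0 = 0 := map0 t F Fev.
have odd_even x : B x -> ~ evens x.
  by move=> [y _ <-] [z _ /esym /odd_neq_even].
split; [split| exact: F0 |exact: (coset2_clopen 1 1)|].
- split.
  + apply/seteqP; split=> // x _.
    have [[y xE]|[u ->]] := even_or_odd x; last by right; exists u.
    left; have [->|x0] := eqVneq x 0; [by left|right].
    have Ex : evens x by exists y.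
    by have [nk Dnk Mx] := component_cover t x Ex x0; exists nk.
  + by apply/seteqP; split=> // _ [-> [nk _ /component_neq0]].
  + apply/seteqP; split=> // _ [-> /odd_even]; apply.
    by exists 0; rewrite // mulr0.
  + apply/seteqP; split=> // x [[nk Dnk Mx] /odd_even]; apply.
    exact: component_evens Mx.
  + move=> nk nk' Dnk Dnk' [x [Mx Mx']].
    exact: component_uniq Dnk Dnk' Mx Mx'.
- split; first exact: finite_set1.
  exact: (periodic_only0 t F Fnt Fev Fodd).
- exact: countableP.
- move=> A; split=> [|[nk Dnk ->]].
    exact: (minimal_component_is_component t F Fnt Fev Fodd).
  exact: (component_minimal t F Fnt Fev).
- move=> x _; have [Fx|[nk Dnk Fx]] := attracted_in_one_step t F Fnt Fev Fodd x.
    exists [set 0] => //; left; exists 0; first by exists 1%N.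
    apply/seteqP; split=> [_ ->|_ [i _ <-]]; first by exists 0%N.
    by elim: i => //= i ->.
  by exists (M nk) => //; right; exact: (component_minimal t F Fnt Fev).
- by move=> x _; exact: (attracted_in_one_step t F Fnt Fev Fodd).
Qed.
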